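(* For every $\alpha\in(0,\frac14)$ there exists an $\alpha'\in(\alpha,\frac12)$ with the following property: for all pairs of integers $(m_A,m_B)$ that are achievable for the semi-linear deterministic combinatorial Slepian--Wolf scheme with parameters $(n,\alpha)$, it holds that $$m_A+m_B \ge (1+h(\alpha'))\,n-o(n).$$ Moreover, the value of $\alpha'$ can be defined explicitly as $$\alpha' := \frac{1-\sqrt{1-4\alpha}}{2}.$$
   Context: Notation: $\mathrm{dist}(x,y)$ is the Hamming distance between binary strings of equal length; $h(\alpha):=-\alpha\log_2\alpha-(1-\alpha)\log_2(1-\alpha)$ is the binary entropy function. The $o(n)$ term denotes a function of $n$ (for fixed $\alpha$) that is asymptotically negligible compared with $n$ as $n\to\infty$. Deterministic combinatorial Slepian--Wolf scheme with parameters $(n,\alpha)$: a pair of coding mappings $$Code_A:\{0,1\}^n\to\{0,1\}^{m_A},\qquad Code_B:\{0,1\}^n\to\{0,1\}^{m_B}$$ is called uniquely decodable (for parameters $(n,\alpha)$) if for each $c_A\in\{0,1\}^{m_A}$ and $c_B\in\{0,1\}^{m_B}$ there exists at most one pair of strings $(x,y)\in\{0,1\}^n\times\{0,1\}^n$ such that $\mathrm{dist}(x,y)\le\alpha n$, $Code_A(x)=c_A$ and $Code_B(y)=c_B$. The scheme is called semi-linear if at least one of the two mappings $Code_A$, $Code_B$ is a linear mapping over the field $\mathbb{F}_2$ (i.e. a linear map $\mathbb{F}_2^n\to\mathbb{F}_2^{m_A}$, respectively $\mathbb{F}_2^n\to\mathbb{F}_2^{m_B}$). A pair of integers $(m_A,m_B)$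 is achievable for the semi-linear deterministic scheme with parameters $(n,\alpha)$ if there exists a semi-linear uniquely decodable pair of coding mappings with these code lengths $m_A$, $m_B$. *)

(* Defs.v *)
From HB Require Import structures.
From mathcomp Require Import all_boot all_order all_algebra.
From mathcomp Require Import all_classical all_reals all_analysis.
Set Implicit Arguments.
Unset Strict Implicit.
Unset Printing Implicit Defensive.
Import Order.TTheory GRing.Theory Num.Theory.
Import numFieldNormedType.Exports.
Local Open Scope classical_set_scope.
Local Open Scope ring_scope.

(* The binary alphabet {0,1} is identified with the field 'F_2, so that
   linearity over F_2 of a coding map is the library predicate [linear]. *)

Definition hamming_dist (n : nat) (x y : 'rV['F_2]_n) : nat :=
  #|[pred i : 'I_n | x 0 i != y 0 i]|.

Definition log2 (R : realType) (x : R) : R := ln x / ln 2.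

(* Since [ln 0 = 0] in the library, this gives h(0) = h(1) = 0, the usual
   convention. *)
Definition binary_entropy (R : realType) (a : R) : R :=
  - a * log2 a - (1 - a) * log2 (1 - a).

Definition uniquely_decodable (R : realType) (n : nat) (alpha : R)
    (mA mB : nat) (codeA : 'rV['F_2]_n -> 'rV['F_2]_mA)
    (codeB : 'rV['F_2]_n -> 'rV['F_2]_mB) : Prop :=
  forall (cA : 'rV['F_2]_mA) (cB : 'rV['F_2]_mB),
    is_subset1 [set xy : 'rV['F_2]_n * 'rV['F_2]_n |
      [/\ (hamming_dist xy.1 xy.2)%:R <= alpha * n%:R,
          codeA xy.1 = cA & codeB xy.2 = cB]].

Definition semi_linear (n mA mB : nat) (codeA : 'rV['F_2]_n -> 'rV['F_2]_mA)
    (codeB : 'rV['F_2]_n -> 'rV['F_2]_mB) : Prop :=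
  linear codeA \/ linear codeB.

Definition semi_linear_achievable (R : realType) (n : nat) (alpha : R)
    (mA mB : nat) : Prop :=
  exists (codeA : 'rV['F_2]_n -> 'rV['F_2]_mA)
         (codeB : 'rV['F_2]_n -> 'rV['F_2]_mB),
    semi_linear codeA codeB /\ uniquely_decodable alpha codeA codeB.

(* For a given alpha the error term is one function of n, common to all
   achievable pairs (mA, mB). *)
Definition sum_rate_bound (R : realType) (alpha alpha' : R) : Prop :=
  exists f : nat -> R,
    f =o_\oo (fun n : nat => n%:R : R) /\
    forall n mA mB : nat, semi_linear_achievable n alpha mA mB ->
      (mA + mB)%:R >= (1 + binary_entropy alpha') * n%:R - f n.

(* Main.v *)
(** Let F and S be largest fibres of the linear and of the other coding map.
    Unique decodability says that the differences y - x, with x in F and y in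
    S, are pairwise distinct and form a code of minimum distance larger than
    2 * floor (alpha * n): a difference of two such words of smaller weight
    would split as e1 - e2 with both weights at most alpha * n, and linearity
    would turn it into two pairs with the same codewords.  This code has at
    least 2 ^ (2n - mA - mB) elements, so the Elias-Bassalygo bound applies:
    by Johnson's bound a sphere of radius slightly less than alpha' * n
    contains at most n codewords, since alpha' * (1 - alpha') = alpha, and
    averaging over all centres yields
    2 ^ (2n - mA - mB) * 'C(n, r) <= 2 ^ n * n. *)

Require Import Defs.
From HB Require Import structures.
From mathcomp Require Import all_boot all_order all_algebra.
From mathcomp Require Import all_classical all_reals all_analysis.
From mathcomp Require Import ring lra.
Import Order.TTheory GRing.Theory Num.Theory.
Import numFieldNormedType.Exports.
Local Open Scope ring_scope.

(** * Hamming distance over ['F_2] *)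

(** Letters differing from a third one coincide, because the alphabet is binary; Johnson's bound
    uses this to count distances coordinate by coordinate. *)
Lemma F2_neq_addb (x y z : 'F_2) : (x != y) = (x != z) (+) (y != z).
Proof.
by case: x => [[|[|x]] //= ?]; case: y => [[|[|y]] //= ?];
  case: z => [[|[|z]] //= ?].
Qed.

Lemma hamming_distE (R : pzSemiRingType) n (x y : 'rV['F_2]_n) :
  (hamming_dist x y)%:R = \sum_i (x 0 i != y 0 i)%:R :> R.
Proof.
rewrite /hamming_dist -sum1_card natr_sum [LHS]big_mkcond.
by apply: eq_bigr => i _; rewrite inE; case: (_ != _).
Qed.

Lemma hamming_distC n (x y : 'rV['F_2]_n) : hamming_dist x y = hamming_dist y x.
Proof. by apply: eq_card => i; rewrite !inE eq_sym. Qed.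

Lemma hamming_distxx n (x : 'rV['F_2]_n) : hamming_dist x x = 0%N.
Proof. by apply: eq_card0 => i; rewrite !inE eqxx. Qed.

Lemma hamming_dist_card n (x y : 'rV['F_2]_n) :
  hamming_dist x y = #|[set i | x 0 i != y 0 i]|.
Proof. by apply: eq_card => i; rewrite !inE. Qed.

(** To reach [z], switch from [x] to [y] on at most [t] of the coordinates where they differ,
    leaving at most [t] differences. *)
Lemma hamming_dist_split n (x y : 'rV['F_2]_n) t :
  (hamming_dist x y <= t.*2)%N ->
  exists2 z, (hamming_dist x z <= t)%N & (hamming_dist z y <= t)%N.
Proof.
rewrite hamming_dist_card; set A := [set i | _] => leA.
have [leAt|/ltnW letA] := leqP #|A| t.
  by exists y; rewrite ?hamming_distxx// hamming_dist_card.
have [B sBA Bt] : exists2 B : {set 'I_n}, B \subset A & #|B| = t.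
  exists [set i in take t (enum A)].
    by apply/fintype.subsetP => i; rewrite inE => /mem_take; rewrite mem_enum.
  have := take_uniq t (enum_uniq A); rewrite cardsE => /card_uniqP ->.
  by rewrite size_takel// -cardE.
exists (\row_i if i \in B then y 0 i else x 0 i); rewrite hamming_dist_card.
  rewrite -[leqRHS]Bt subset_leq_card//; apply/fintype.subsetP => i.
  by rewrite !inE mxE; case: ifP => //; rewrite eqxx.
suff : (#|A :\: B| <= t)%N.
  apply: leq_trans; rewrite subset_leq_card//; apply/fintype.subsetP => i.
  by rewrite !inE mxE; case: ifP => //; rewrite eqxx.
by rewrite finset.cardsD (finset.setIidPr sBA) Bt leq_subLR addnn.
Qed.

(** * Johnson's bound and averaging over spheres *)

(** The sum of all pairwise distances in [L] is estimated in two ways. Coordinate [i] contributes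
    [2 * k i * (M - k i)], where [k i] counts the words of [L] that differ from [z] there. *)
Lemma johnson_bound (R : realFieldType) n (d lam : R) (z : 'rV['F_2]_n)
    (L : {set 'rV['F_2]_n}) :
  lam <= 1 / 2 ->
  {in L, forall x, (hamming_dist x z)%:R <= lam * n%:R} ->
  {in L &, forall x y, x != y -> d <= (hamming_dist x y)%:R} ->
  #|L|%:R * (#|L|%:R - 1) * d <= 2 * n%:R * (lam * (1 - lam)) * #|L|%:R ^+ 2.
Proof.
move=> lam2 Lz Ld; set M : R := #|L|%:R.
pose k i : R := \sum_(x in L) (x 0 i != z 0 i)%:R.
have sumk : \sum_i k i <= M * (lam * n%:R).
  rewrite exchange_big /= /M -sumr_const mulr_suml.
  by apply: ler_sum => x xL; rewrite -hamming_distE mul1r Lz.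
have -> : M * (M - 1) * d = \sum_(x in L) \sum_(y in L | y != x) d.
  transitivity (\sum_(x in L) (M - 1) * d).
    by rewrite sumr_const -mulr_natl mulrA.
  apply: eq_bigr => x xL; rewrite sumr_const -[_ *+ _]mulr_natl; congr (_ * _).
  rewrite /M (cardD1 x L) xL natrD addrC addKr; congr _%:R.
  by apply: eq_card => y; rewrite !inE andbC.
apply: (@le_trans _ _ (\sum_(x in L) \sum_(y in L) (hamming_dist x y)%:R)).
  apply: ler_sum => x xL; rewrite big_mkcondr; apply: ler_sum => y yL.
  by case: ifP => // yx; rewrite Ld// eq_sym.
have -> : \sum_(x in L) \sum_(y in L) (hamming_dist x y)%:R =
    \sum_i (2 * M * k i - 2 * k i ^+ 2) :> R.
  under eq_bigr => x _.
    under eq_bigr => y _ do rewrite hamming_distE.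
    rewrite exchange_big /=; over.
  rewrite exchange_big; apply: eq_bigr => i _ /=.
  transitivity (\sum_(x in L) (k i + M * (x 0 i != z 0 i)%:R
      - 2 * k i * (x 0 i != z 0 i)%:R)).
    apply: eq_bigr => x xL.
    have -> : M * (x 0 i != z 0 i)%:R = \sum_(y in L) (x 0 i != z 0 i)%:R.
      by rewrite sumr_const mulr_natl.
    rewrite -mulrA (mulrC (k i)) mulrA mulr_sumr -big_split -sumrB /=.
    apply: eq_bigr => y yL; rewrite (F2_neq_addb _ _ (z 0 i)).
    by case: (x 0 i != _); case: (y 0 i != _) => /=; ring.
  rewrite sumrB big_split sumr_const -!mulr_sumr -[_ *+ _]mulr_natl -/M -/(k i) /=.
  ring.
(* Tangent line at [lam * M] of the concave function [k |-> k * (M - k)]. *)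
have kle i : 2 * M * k i - 2 * k i ^+ 2 <=
    2 * M * (1 - 2 * lam) * k i + 2 * (lam * M) ^+ 2.
  have := sqr_ge0 (k i - lam * M); nra.
apply: (le_trans (ler_sum _ (fun i _ => kle i))).
rewrite big_split -mulr_sumr sumr_const card_ord -[_ *+ _]mulr_natl /=.
(* The tangent has nonnegative slope because [lam <= 1 / 2], so the upper bound [sumk] can be
   inserted. *)
have M0 : 0 <= 2 * M * (1 - 2 * lam) by rewrite mulr_ge0 ?mulr_ge0// ?ler0n//; lra.
have := ler_wpM2l M0 sumk; lra.
Qed.

Lemma card_hamming_sphere n r (x : 'rV['F_2]_n) :
  ('C(n, r) <= #|[set z | hamming_dist x z == r]|)%N.
Proof.
pose v (A : {set 'I_n}) := x + \row_i (i \in A)%:R.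
have vE A i : (x 0 i != v A 0 i) = (i \in A).
  rewrite !mxE -subr_eq0 opprD addNKr oppr_eq0.
  by case: (i \in A); rewrite ?oner_eq0 ?eqxx.
have v_inj : injective v by move=> A B vAB; apply/finset.setP => i; rewrite -!vE vAB.
rewrite -[n in 'C(n, r)]card_ord -card_draws -(card_imset _ v_inj).
apply/subset_leq_card/fintype.subsetP => _ /imsetP[A + ->].
rewrite !inE => /eqP <-; apply/eqP.
by apply: eq_card => i; rewrite inE vE.
Qed.

(** Pairs at distance exactly [r] are counted: at least ['C(n, r)] centres [z] for each [x] in [D],
    at most [M] words of [D] for each [z]. *)
Lemma elias_bassalygo_double_count n r M (D : {set 'rV['F_2]_n}) :
  (forall z, #|[set x in D | hamming_dist x z == r]| <= M)%N ->
  (#|D| * 'C(n, r) <= 2 ^ n * M)%N.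
Proof.
move=> leM.
have -> : (2 ^ n = #|{: 'rV['F_2]_n}|)%N by rewrite card_mx mul1n card_Fp.
rewrite -!sum_nat_const.
apply: (@leq_trans (\sum_(x in D) \sum_z (hamming_dist x z == r))).
  apply: leq_sum => x _; apply: (leq_trans (card_hamming_sphere _ r x)).
  rewrite -sum1_card big_mkcond; apply: leq_sum => z _.
  by rewrite inE; case: ifP.
rewrite exchange_big; apply: leq_sum => z _ /=.
apply: leq_trans (leM z); rewrite -sum1_card [leqRHS]big_mkcond [leqLHS]big_mkcond /=.
by apply: leq_sum => x _; rewrite inE; case: (x \in D); case: (_ == r).
Qed.

(** * From a coding scheme to a code of large distance *)

Lemma large_fiber (T U : finType) (f : T -> U) : (0 < #|U|)%N ->
  exists u, (#|T| <= #|[set x | f x == u]| * #|U|)%N.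
Proof.
move=> U0; apply/not_existsP => small.
have : (#|T| * #|U| < #|T| * #|U|)%N.
  rewrite -{1}sum1_card (partition_big f xpredT)//= big_distrl /=.
  rewrite [ltnRHS]mulnC -[ltnRHS]sum_nat_const.
  have [u0 _] := card_gt0P U0.
  apply: (@leq_ltn_trans (\sum_u (#|[set x | f x == u]| * #|U|))).
    by apply: leq_sum => u _; rewrite -sum1dep_card.
  rewrite (bigD1 u0)//= [ltnRHS](bigD1 u0)//= -addSn leq_add//.
    by rewrite ltnNge; apply/negP/small.
  by apply: leq_sum => u _; rewrite ltnW// ltnNge; apply/negP/small.
by rewrite ltnn.
Qed.

Lemma linear_decodable_code n t mA mB (codeA : 'rV['F_2]_n -> 'rV['F_2]_mA)
    (codeB : 'rV['F_2]_n -> 'rV['F_2]_mB) :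
  linear codeA ->
  (forall x y x' y', (hamming_dist x y <= t)%N -> (hamming_dist x' y' <= t)%N ->
     codeA x = codeA x' -> codeB y = codeB y' -> (x, y) = (x', y')) ->
  exists D : {set 'rV['F_2]_n},
    (2 ^ (n + n) <= #|D| * 2 ^ (mA + mB))%N /\
    {in D &, forall u v, u != v -> (t.*2 < hamming_dist u v)%N}.
Proof.
move=> linA dec.
have rV0 m : (0 < #|{: 'rV['F_2]_m}|)%N by apply/card_gt0P; exists 0.
have card_rV m : #|{: 'rV['F_2]_m}| = (2 ^ m)%N by rewrite card_mx mul1n card_Fp.
have [a Fa] := large_fiber _ _ codeA (rV0 mA).
have [b Fb] := large_fiber _ _ codeB (rV0 mB).
move: Fa Fb; rewrite !card_rV.
set F := [set x | codeA x == a]; set S := [set x | codeB x == b] => leF leS.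
have codeAB x y : codeA (x - y) = codeA x - codeA y.
  by rewrite addrC -scaleN1r linA scaleN1r addrC.
have key x y x' y' : x \in F -> y \in S -> x' \in F -> y' \in S ->
    (hamming_dist (y - x)%R (y' - x')%R <= t.*2)%N -> (x, y) = (x', y').
  rewrite !inE => /eqP xa /eqP yb /eqP xa' /eqP yb' /hamming_dist_split[z zx zy].
  (* With [z] midway between [y - x] and [y' - x'], both shifted pairs have distance at most [t];
     linearity keeps the codewords of [z + x] and [z + x'] equal. *)
  suff [/addrI -> ->] : (z + x, y) = (z + x', y') by [].
  apply: dec.
  - rewrite hamming_distC; apply: leq_trans zx.
    rewrite !hamming_dist_card.
    apply/subset_leq_card/fintype.subsetP => i; rewrite !inE !mxE.
    by apply: contraNN => /eqP <-; rewrite subrK.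
  - apply: leq_trans zy; rewrite !hamming_dist_card.
    apply/subset_leq_card/fintype.subsetP => i; rewrite !inE !mxE.
    by apply: contraNN => /eqP ->; rewrite subrK.
  - apply/eqP; rewrite -subr_eq0 -codeAB opprD addrACA subrr add0r codeAB.
    by rewrite xa xa' subrr.
  - by rewrite yb yb'.
exists [set xy.2 - xy.1 | xy in finset.setX F S]; split.
  (* Injectivity of the difference map on [F] times [S] is [key] at distance 0. *)
  rewrite card_in_imset ?cardsX.
    by rewrite !expnD mulnACA leq_mul.
  move=> [x y] [x' y'] /setXP[/= xF yS] /setXP[/= xF' yS'] e.
  by apply: key => //; rewrite e hamming_distxx.
move=> _ _ /imsetP[[x y] /setXP[/= xF yS] ->] /imsetP[[x' y'] /setXP[/= xF' yS'] ->].
rewrite ltnNge; apply: contraNN => /(key _ _ _ _ xF yS xF' yS')[-> ->]; exact/eqP.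
Qed.

(** * Binomial coefficients and entropy *)

(** Here [r] is a mode of the binomial distribution: the [n.+1] weights sum to 1, so the largest is
    at least their average. Comparison with the neighbouring weights locates [r]. *)
Lemma binomial_mode (R : realFieldType) n (p : R) : 0 < p < 1 ->
  exists r, [/\ (r <= n)%N, r%:R <= n.+1%:R * p, n.+1%:R * p - 1 <= r%:R &
    1 <= n.+1%:R * ('C(n, r)%:R * p ^+ r * (1 - p) ^+ (n - r))].
Proof.
move=> /andP[p0 p1]; have q0 : 0 < 1 - p by rewrite subr_gt0.
pose w i : R := 'C(n, i)%:R * p ^+ i * (1 - p) ^+ (n - i).
have [r _ rmax] := arg_maxP (fun i : 'I_n.+1 => w i) (isT : xpredT ord0).
have w_gt0 i : (i <= n)%N -> 0 < w i.
  by move=> lein; rewrite !mulr_gt0 ?exprn_gt0// ltr0n bin_gt0.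
have step i : (i < n)%N ->
    w i.+1 * (i.+1%:R * (1 - p)) = w i * ((n%:R - i%:R) * p).
  move=> ltin; rewrite /w -(subnSK ltin) -natrB 1?ltnW// !exprS.
  have := congr1 (fun k => k%:R : R) (mul_bin_left n i); rewrite /= !natrM => e.
  transitivity ((i.+1%:R * 'C(n, i.+1)%:R) *
    (p ^+ i * (1 - p) ^+ (n - i.+1) * (p * (1 - p)))); first by ring.
  by rewrite e; ring.
exists r; split.
- by rewrite -ltnS.
- case: (posnP r) => [->|r0]; first by rewrite mulr_ge0 ?ler0n ?ltW.
  have [j rE] : {j | r = j.+1 :> nat} by exists r.-1; rewrite prednK.
  have ltjn : (j < n)%N by rewrite -rE -ltnS.
  have := rmax (Ordinal (leqW ltjn)) isT; rewrite /= rE => wle.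
  have := step _ ltjn.
  have jn : j%:R + 1 <= n%:R :> R by rewrite natr1 ler_nat.
  have := w_gt0 _ (ltnW ltjn); rewrite -!natr1 => wj0 e.
  have : w j * ((j%:R + 1) * (1 - p)) <= w j * ((n%:R - j%:R) * p).
    by rewrite -e ler_wpM2r// mulr_ge0 ?(ltW q0)// addr_ge0.
  by rewrite ler_pM2l//; lra.
- have := ltn_ord r; rewrite ltnS leq_eqVlt => /orP[/eqP ->|ltrn].
    have : 0 <= n%:R :> R by []; rewrite -natr1; nra.
  have := rmax (Ordinal (ltrn : r.+1 < n.+1)%N) isT; rewrite /= => wle.
  have := step _ ltrn; have := w_gt0 _ (ltnW ltrn); rewrite -!natr1 => wr0 e.
  have : w r * ((n%:R - r%:R) * p) <= w r * ((r%:R + 1) * (1 - p)).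
    by rewrite -e ler_wpM2r// mulr_ge0 ?(ltW q0)// addr_ge0.
  by rewrite ler_pM2l//; lra.
have sumw : \sum_(i < n.+1) w i = 1.
  rewrite -[RHS](expr1n _ n) -[X in X ^+ n](subrK p 1) exprDn.
  by apply: eq_bigr => i _; rewrite /w -[RHS]mulr_natl; ring.
rewrite -/(w r).
have -> : n.+1%:R * w r = \sum_(i < n.+1) w r by rewrite sumr_const card_ord mulr_natl.
by rewrite -sumw; apply: ler_sum => i _; exact: rmax.
Qed.

(** The logarithm of the bound on the modal weight is linear in [r], with slope
    [ln (1 - p) - ln p >= 0]. Since [r >= n%:R * p - 1], replacing [r] by [n%:R * p] costs at most
    [- ln p]. *)
Lemma ln_binomial_ge (R : realType) n (p : R) : 0 < p <= 1 / 2 ->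
  exists2 r, r%:R <= n%:R * p + 1 &
    n%:R * binary_entropy p * ln 2 + ln p - ln n.+1%:R <= ln 'C(n, r)%:R.
Proof.
move=> /andP[p0 p2]; have p01 : 0 < p < 1 by apply/andP; split; lra.
have [r [rn ler ger bin1]] := binomial_mode R n p p01.
exists r; first by move: ler; rewrite -natr1; lra.
have bin0 : 0 < 'C(n, r)%:R :> R by rewrite ltr0n bin_gt0.
have q0 : 0 < 1 - p by lra.
have : ln 1 <= ln (n.+1%:R * ('C(n, r)%:R * p ^+ r * (1 - p) ^+ (n - r))).
  by rewrite ler_ln ?posrE ?mulr_gt0 ?exprn_gt0.
rewrite ln1 !lnM ?posrE ?mulr_gt0 ?exprn_gt0// !lnXn//.
rewrite -[ln p *+ _]mulr_natr -[ln (1 - p) *+ _]mulr_natr natrB//.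
have ln20 : ln 2 != 0 :> R by rewrite gt_eqF// ln_gt0// ltr1n.
have -> : n%:R * binary_entropy p * ln 2 =
    n%:R * (- p * ln p - (1 - p) * ln (1 - p)) :> R.
  by rewrite /binary_entropy /log2; field.
have lpq : ln p <= ln (1 - p) by rewrite ler_ln ?posrE//; lra.
have lq0 : ln (1 - p) <= 0 by apply: ln_le0; lra.
have : 0 <= (r%:R - n%:R * p + 1) * (ln (1 - p) - ln p).
  by apply: mulr_ge0; [move: ger; rewrite -natr1; lra|rewrite subr_ge0].
lra.
Qed.

(** * The bound at a fixed length *)

Lemma achievable_code (R : realType) n (alpha : R) mA mB : 0 <= alpha ->
  semi_linear_achievable n alpha mA mB ->
  exists D : {set 'rV['F_2]_n},
    (2 ^ (n + n) <= #|D| * 2 ^ (mA + mB))%N /\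
    {in D &, forall u v, u != v ->
      2 * (alpha * n%:R) - 1 <= (hamming_dist u v)%:R}.
Proof.
move=> a0 [codeA [codeB [lin dec]]].
have an0 : 0 <= alpha * n%:R by rewrite mulr_ge0.
pose t := Num.truncn (alpha * n%:R).
have dect x y x' y' : (hamming_dist x y <= t)%N -> (hamming_dist x' y' <= t)%N ->
    codeA x = codeA x' -> codeB y = codeB y' -> (x, y) = (x', y').
  rewrite !truncn_ge_nat// => xy xy' eA eB.
  exact: (dec (codeA x') (codeB y')).
have [D [cardD distD]] : exists D : {set 'rV['F_2]_n},
    (2 ^ (n + n) <= #|D| * 2 ^ (mA + mB))%N /\
    {in D &, forall u v, u != v -> (t.*2 < hamming_dist u v)%N}.
  case: lin => lin; first exact: (@linear_decodable_code _ _ _ _ codeA codeB).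
  (* If [codeB] is the linear map, the roles are swapped by symmetry of the distance. *)
  rewrite addnC; apply: (@linear_decodable_code _ _ _ _ codeB codeA) => //.
  move=> y x y' x' yx yx' eB eA.
  suff [-> ->] : (x, y) = (x', y') by [].
  by apply: dect; rewrite // hamming_distC.
exists D; split => // u v uD vD uv.
(* Rounding: [2 * t + 1] exceeds [2 * (alpha * n%:R) - 1] because [t > alpha * n%:R - 1]. *)
have := distD u v uD vD uv; have /andP[_] := truncn_itv an0.
rewrite -/t -(ler_nat R) -!natr1 -muln2 natrM; lra.
Qed.

(** The slack between [p] and [lam] absorbs the rounding of the radius [r], and the slack between
    [lam * (1 - lam)] and [alpha] keeps Johnson's list size at most [n]. One [ln n.+1%:R] comes from
    this list size, the other from the binomial estimate. *)
Lemma achievable_entropy_bound (R : realType) n (alpha lam p : R) mA mB :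
  (0 < n)%N -> 0 <= alpha <= 1 / 2 -> 0 < p -> lam <= 1 / 2 ->
  n%:R * p + 1 <= n%:R * lam -> n%:R * (lam * (1 - lam)) <= n%:R * alpha - 1 ->
  semi_linear_achievable n alpha mA mB ->
  (1 + binary_entropy p) * n%:R * ln 2 + ln p - 2 * ln n.+1%:R <=
    (mA + mB)%:R * ln 2.
Proof.
move=> n0 /andP[a0 a2] p0 lam2 plam lamalpha /(achievable_code _ _ _ _ _ a0).
move=> [D [cardD distD]].
have nR : 0 < n%:R :> R by rewrite ltr0n.
have plam' : p <= lam by rewrite -(ler_pM2l nR); lra.
have [|r rp lnC] := ln_binomial_ge R n p; first by apply/andP; split; lra.
have listD z : (#|[set x in D | hamming_dist x z == r]| <= n)%N.
  set L := [set x in D | _]; have [->//|L0] := posnP #|L|.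
  have L1 : 0 < #|L|%:R :> R by rewrite ltr0n.
  have : #|L|%:R * (#|L|%:R - 1) * (2 * (alpha * n%:R) - 1) <=
      2 * n%:R * (lam * (1 - lam)) * #|L|%:R ^+ 2.
    apply: (@johnson_bound _ _ _ _ z) => //.
      by move=> x; rewrite inE => /andP[_ /eqP ->]; rewrite mulrC; lra.
    by move=> x y; rewrite !inE => /andP[xD _] /andP[yD _]; exact: distD.
  move=> le1; have {}le1 : (#|L|%:R - 1) * (2 * (alpha * n%:R) - 1) <=
      2 * n%:R * (lam * (1 - lam)) * #|L|%:R.
    by rewrite -(ler_pM2l L1); move: le1; rewrite expr2; lra.
  have le2 := ler_wpM2r (ltW L1) lamalpha.
  (* The two inequalities give [#|L| <= 2 * alpha * n - 1], which is below [n]. *)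
  have : n%:R * alpha <= n%:R * (1 / 2) by rewrite ler_pM2l.
  rewrite -(ler_nat R); lra.
have C0 : (0 < 'C(n, r))%N.
  rewrite bin_gt0 -(ler_nat R); apply: (le_trans rp); apply: (le_trans plam).
  by rewrite ler_piMr//; lra.
have : (2 ^ n * 'C(n, r) <= n.+1 * 2 ^ (mA + mB))%N.
  rewrite -(@leq_pmul2l (2 ^ n)) ?expn_gt0// mulnA -expnD.
  have := elias_bassalygo_double_count _ _ _ _ listD => e.
  apply: (leq_trans (leq_mul cardD (leqnn _))).
  rewrite mulnAC mulnA leq_mul// (leq_trans e)// leq_mul//.
have ln2 : 0 < ln 2 :> R by rewrite ln_gt0// ltr1n.
rewrite -(ler_nat R) -ler_ln ?posrE ?ltr0n ?muln_gt0 ?expn_gt0 ?C0//.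
rewrite !natrM !natrX !lnM ?posrE ?exprn_gt0 ?ltr0n// !lnXn ?ltr0n//.
rewrite -[ln 2 *+ n]mulr_natr -[ln 2 *+ _]mulr_natr.
have : 0 <= ln n.+1%:R :> R by rewrite ln_ge0// ler1n.
lra.
Qed.

(** * Asymptotics and conclusion *)

Lemma cvg_binary_entropy (R : realType) (a : R) (u : nat -> R) :
  0 < a < 1 -> (u @ \oo --> a ->
  (fun n => binary_entropy (u n)) @ \oo --> binary_entropy a)%classic.
Proof.
move=> /andP[a0 a1] ua.
have lnu : ((fun n => ln (u n)) @ \oo --> ln a)%classic.
  exact: (continuous_cvg _ (continuous_ln a0) ua).
have u1 : ((fun n => 1 - u n) @ \oo --> 1 - a)%classic.
  by apply: cvgB => //; exact: cvg_cst.
have lnu1 : ((fun n => ln (1 - u n)) @ \oo --> ln (1 - a))%classic.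
  by apply: (continuous_cvg _ (continuous_ln _) u1); rewrite subr_gt0.
apply: cvgB; apply: cvgM => //; first exact: cvgN.
  by apply: cvgM => //; exact: cvg_cst.
by apply: cvgM => //; exact: cvg_cst.
Qed.

(** This is [ln (1 + y) <= y] at [y = delta * x - 1]; with [delta] arbitrarily small it makes
    logarithmic errors [o(n)]. *)
Lemma ln_le_mulr_delta (R : realType) (delta x : R) : 0 < delta -> 0 < x ->
  ln x <= delta * x - ln delta.
Proof.
move=> d0 x0; rewrite lerBrDr -lnM ?posrE// mulrC.
have dx0 : 0 < delta * x by rewrite mulr_gt0.
have := @le_ln1Dx R (delta * x - 1); rewrite addrCA subrr addr0; lra.
Qed.

Theorem theorem2 (R : realType) (alpha : R) (halpha : 0 < alpha < 1 / 4) :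
  exists alpha' : R,
    [/\ alpha < alpha' < 1 / 2,
        sum_rate_bound alpha alpha'
      & alpha' = (1 - Num.sqrt (1 - 4 * alpha)) / 2].
Proof.
have /andP[al0 al1] := halpha.
set a := (1 - Num.sqrt (1 - 4 * alpha)) / 2; exists a.
(* [a] is the smaller root of [x * (1 - x) = alpha], and [s] is the derivative of [x * (1 - x)]
   there. *)
pose s := 1 - 2 * a.
have sE : s = Num.sqrt (1 - 4 * alpha) by rewrite /s /a; field.
have s0 : 0 < s by rewrite sE sqrtr_gt0; lra.
have s2 : s ^+ 2 = 1 - 4 * alpha by rewrite sE sqr_sqrtr//; lra.
have aE : a * (1 - a) = alpha.
  have -> : a = (1 - s) / 2 by rewrite /s; field.
  have -> : alpha = (1 - s ^+ 2) / 4 by rewrite s2; field.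
  by field.
have a2 : a < 1 / 2 by move: s0; rewrite /s; lra.
have a0 : 0 < a.
  rewrite ltNge; apply/negP => a_le0.
  by have : a * (1 - a) <= 0 by [rewrite mulr_le0_ge0//; lra]; lra.
have alta : alpha < a by rewrite -aE; nra.
split => //; first by rewrite alta.
(* Lowering [a] by [s^-1 / n] decreases [x * (1 - x)] by at least [1 / n], which gives [lam]; the
   further [1 / n] makes [n * p n + 1 = n * lam]. *)
pose p n := a - (s^-1 + 1) * n%:R^-1.
have cp : (p @ \oo --> a)%classic.
  rewrite -[X in (_ --> X)%classic]subr0; apply: cvgB; first exact: cvg_cst.
  rewrite -[X in (_ --> X)%classic](mulr0 (s^-1 + 1)).
  apply: cvgM; first exact: cvg_cst.
  apply/gtr0_cvgV0; last exact: cvgr_idn.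
  by near=> n; rewrite ltr0n; near: n; exact: nbhs_infty_gt.
have ch : ((fun n => binary_entropy (p n)) @ \oo --> binary_entropy a)%classic.
  by apply: cvg_binary_entropy cp; apply/andP; split; lra.
have ln2 : 0 < ln 2 :> R by rewrite ln_gt0// ltr1n.
(* The default value makes the bound read [0 <= mA + mB]; it occurs for finitely many [n], as [p n]
   tends to [a > 0]. *)
exists (fun n => if (0 < n)%N && (0 < p n) then
    n%:R * (binary_entropy a - binary_entropy (p n)) +
      (2 * ln n.+1%:R - ln (p n)) / ln 2
  else (1 + binary_entropy a) * n%:R); split.
- apply/eqoP => e e0.
  (* With this [d], the term [2 * ln n.+1%:R / ln 2] grows at most like [e / 4 * n]. The entropy
     difference takes [e / 2 * n] and the constant [K] the remaining [e / 4 * n]. *)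
  pose d := e * ln 2 / 8.
  have d0 : 0 < d by rewrite divr_gt0// mulr_gt0.
  pose K := (2 * (d - ln d) - ln (a / 2)) / ln 2.
  have KE : K * ln 2 = 2 * (d - ln d) - ln (a / 2) by rewrite divfK// gt_eqF.
  near=> n.
  have n0 : (0 < n)%N by near: n; exact: nbhs_infty_gt.
  have nR : 0 < n%:R :> R by rewrite ltr0n.
  have pa2 : a / 2 < p n by near: n; apply: (cvgr_gt _ cp); lra.
  have he : `|binary_entropy a - binary_entropy (p n)| < e / 2.
    by near: n; apply: (cvgr_dist_lt _ _ ch); rewrite divr_gt0.
  have Kn : K / (e / 4) < n%:R by near: n; exact: nbhs_infty_gtr.
  have pn0 : 0 < p n by lra.
  rewrite n0 pn0 /= [X in _ <= _ * X](gtr0_norm nR).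
  have pna : p n <= a.
    rewrite /p gerBl mulr_ge0// ?invr_ge0 ?ltW//.
    by rewrite addr_gt0// invr_gt0.
  have ge0 : 0 <= (2 * ln n.+1%:R - ln (p n)) / ln 2.
    apply: divr_ge0; last exact: ltW.
    have : ln (p n) <= 0 by apply: ln_le0; lra.
    have : 0 <= ln n.+1%:R :> R by rewrite ln_ge0// ler1n.
    lra.
  have le1 : (2 * ln n.+1%:R - ln (p n)) / ln 2 <= e / 4 * n%:R + K.
    rewrite ler_pdivrMr// [leRHS]mulrDl KE.
    have := ln_le_mulr_delta _ _ n.+1%:R d0 (ltr0Sn _ n).
    rewrite -natr1.
    have : ln (a / 2) <= ln (p n) by rewrite ler_ln ?posrE; lra.
    rewrite /d; lra.
  have le2 : K < e / 4 * n%:R by rewrite mulrC -ltr_pdivrMr// divr_gt0.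
  apply: (le_trans (ler_normD _ _)); rewrite normrM (ger0_norm ge0) (gtr0_norm nR).
  have := ler_wpM2l (ltW nR) (ltW he); lra.
move=> n mA mB ach; case: ifP => [/andP[n0 pn0]|_]; last first.
  by rewrite subrr ler0n.
have nR : 0 < n%:R :> R by rewrite ltr0n.
have si0 : 0 < s^-1 by rewrite invr_gt0.
have nn : n%:R * n%:R^-1 = 1 :> R by rewrite mulfV ?gt_eqF.
have ni0 : 0 < n%:R^-1 :> R by rewrite invr_gt0.
have ss : s * s^-1 = 1 by rewrite mulfV ?gt_eqF.
have := @achievable_entropy_bound R n alpha (a - s^-1 * n%:R^-1) (p n) mA mB n0.
have -> : n%:R * p n + 1 = n%:R * (a - s^-1 * n%:R^-1).
  rewrite /p; ring: nn.
have lam2 : a - s^-1 * n%:R^-1 <= 1 / 2.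
  have := mulr_gt0 si0 ni0; lra.
have lamle : n%:R * ((a - s^-1 * n%:R^-1) * (1 - (a - s^-1 * n%:R^-1))) <=
    n%:R * alpha - 1.
  (* Exact second-order expansion at [a]: the linear term equals 1 and the quadratic term has the
     favourable sign. *)
  have -> : n%:R * ((a - s^-1 * n%:R^-1) * (1 - (a - s^-1 * n%:R^-1))) =
      n%:R * (a * (1 - a)) - (n%:R * n%:R^-1) * (s * s^-1)
        - (n%:R * n%:R^-1) * s^-1 ^+ 2 * n%:R^-1.
    by rewrite /s; ring.
  by rewrite aE nn ss !mul1r gerBl mulr_ge0 ?exprn_ge0 ?ltW.
move=> /(_ _ pn0 lam2 (lexx _) lamle ach) main.
have {}main := main _.
rewrite -(ler_pM2r ln2).
have -> : ((1 + binary_entropy a) * n%:R -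
    (n%:R * (binary_entropy a - binary_entropy (p n)) +
     (2 * ln n.+1%:R - ln (p n)) / ln 2)) * ln 2 =
    (1 + binary_entropy (p n)) * n%:R * ln 2 + ln (p n) - 2 * ln n.+1%:R.
  by field; rewrite gt_eqF.
by apply: main; apply/andP; split; lra.
Unshelve. all: by end_near.
Qed.
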